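(* In the supersample setting described in the context, assume the loss takes values in $[0,1]$. Then \[ \left|\mathrm{Err}\right| \leq\frac{1}{n}\sum_{i=1}^n\mathbb{E}_{\widetilde{Z}}\sqrt{2I^{\widetilde{Z}}(\Delta L_i;U_i)}\leq\frac{1}{n}\sum_{i=1}^n\sqrt{2I(\Delta L_i;U_i\mid\widetilde{Z})}. \]
   Context: Let $\mathcal Z=\mathcal X\times\mathcal Y$ and let $\mu$ be a distribution on $\mathcal Z$. A (possibly randomized) learning algorithm $\mathcal A$ maps a training sample in $\mathcal Z^n$ to a hypothesis $W\in\mathcal W$ (it is described by a conditional distribution $P_{W|S}$), and $\ell:\mathcal W\times\mathcal Z\to[0,\infty)$ is a loss. For $S=(Z_1,\dots,Z_n)\sim\mu^{n}$ and $W\sim P_{W|S}$, let $L_\mu=\mathbb E_W\mathbb E_{Z'\sim\mu}[\ell(W,Z')]$ (with $Z'$ independent of $(S,W)$), $L_S(w)=\frac1n\sum_{i=1}^n\ell(w,Z_i)$, $L_n=\mathbb E_{W,S}[L_S(W)]$ and $\mathrm{Err}=L_\mu-L_n$. Supersample: $\widetilde Z=(\widetilde Z_{i,j})_{i\in\{1,\dots,n\},j\in\{0,1\}}$ has i.i.d. entries with law $\mu$; $U=(U_1,\dots,U_n)$ is uniform on $\{0,1\}^n$ and independent of $\widetilde Z$; the training sample is $\widetilde Z_U=(\widetilde Z_{1,U_1},\dots,\widetilde Z_{n,U_n})$ and $W=\mathcal A(\widetilde Z_U)$ (so $(\widetilde Z_U,W)$ has the law of $(S,W)$). Put $L_{i,j}=\ell(W,\widetilde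 Z_{i,j})$, $L_i^+=L_{i,0}$, $L_i^-=L_{i,1}$ and $\Delta L_i=L_i^- - L_i^+$. Mutual information is in nats. For a realization $\tilde z$ of $\widetilde Z$, the disintegrated mutual information is $I^{\tilde z}(X;Y)=D_{\mathrm{KL}}(P_{X,Y|\widetilde Z=\tilde z}\,\|\,P_{X|\widetilde Z=\tilde z}P_{Y|\widetilde Z=\tilde z})$, so $I(X;Y\mid\widetilde Z)=\mathbb E_{\widetilde Z}[I^{\widetilde Z}(X;Y)]$. *)

(* Defs.v *)
From HB Require Import structures.
From mathcomp Require Import all_boot all_order all_algebra.
From mathcomp Require Import all_classical all_reals all_analysis.
Set Implicit Arguments. Unset Strict Implicit. Unset Printing Implicit Defensive.
Import Order.TTheory GRing.Theory Num.Theory.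
Local Open Scope classical_set_scope.
Local Open Scope ring_scope.

Definition is_density d (T : measurableType d) (R : realType)
    (P Q : set T -> \bar R) (f : T -> R) : Prop :=
  [/\ measurable_fun setT f, (forall x, 0 <= f x) &
      forall A, measurable A -> P A = (\int[Q]_(x in A) (f x)%:E)%E].

(* Kullback-Leibler divergence in nats:
   D(P||Q) = \int log (dP/dQ) dP if P << Q (i.e. a density exists), +oo otherwise *)
Definition KL d (T : measurableType d) (R : realType)
    (P Q : set T -> \bar R) : \bar R :=
  match pselect (exists f, is_density P Q f) with
  | left H => (\int[P]_x (ln (sval (cid H) x))%:E)%E
  | right _ => +oo%E
  end.

Definition mutual_info d1 d2 (X : measurableType d1) (Y : measurableType d2)
    (R : realType) (J : set (X * Y) -> \bar R) : \bar R :=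
  KL J ((fun A => J (A `*` setT)) \x (fun B => J (setT `*` B)))%E.

Definition select (Z : Type) (n : nat) (zt : n.-tuple (Z * Z)) (u : n.-tuple bool)
  : n.-tuple Z :=
  [tuple if tnth u i then (tnth zt i).2 else (tnth zt i).1 | i < n].

Section supersample.
Context (R : realType) (n : nat) (dZ dW : measure_display)
  (Z : measurableType dZ) (W : measurableType dW)
  (A : R.-pker (n.-tuple Z) ~> W) (loss : W -> Z -> R).

Definition DeltaL (zt : n.-tuple (Z * Z)) (i : 'I_n) (w : W) : R :=
  loss w (tnth zt i).2 - loss w (tnth zt i).1.

(* conditional joint law of (Delta L_i, U_i) given Zt = zt:
   U uniform on {0,1}^n, W ~ A(zt_U) *)
Definition cond_joint (zt : n.-tuple (Z * Z)) (i : 'I_n)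
    (E : set (R * bool)) : \bar R :=
  (((2%:R ^+ n)^-1)%:E *
   \sum_(u : n.-tuple bool) A (select zt u) [set w | E (DeltaL zt i w, tnth u i)])%E.

Definition dis_MI (zt : n.-tuple (Z * Z)) (i : 'I_n) : \bar R :=
  mutual_info (cond_joint zt i).
End supersample.

Definition gen_err (R : realType) (n : nat) (dZ dW dO : measure_display)
    (Z : measurableType dZ) (W : measurableType dW) (Omega : measurableType dO)
    (mu : probability Z R) (loss : W -> Z -> R) (P : probability Omega R)
    (Zt : Omega -> n.-tuple (Z * Z)) (U : Omega -> n.-tuple bool) (Wh : Omega -> W)
  : \bar R :=
  (\int[P]_om (\int[mu]_z (loss (Wh om) z)%:E)
   - \int[P]_om ((n%:R^-1 * \sum_(i < n) loss (Wh om) (tnth (select (Zt om) (U om)) i))%:E))%E.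

(* Main.v *)
(* Given the supersample, the ghost point of each pair is a fresh test point, so
   Err is the average over i of the expectation of h_i, the conditional mean of
   (-1)^{U_i} DeltaL_i. For fixed zt, the Donsker-Varadhan inequality with the
   test function t (-1)^{U_i} DeltaL_i - t^2 / 2 bounds the disintegrated mutual
   information from below by t h_i - t^2 / 2: under the product of the marginals
   the sign is independent of DeltaL_i, so the exponential moment is at most
   cosh t * exp (- t^2 / 2) <= 1. Taking t = h_i gives h_i^2 / 2 <= I^zt, and
   the second inequality is Jensen's. *)
Require Import Defs.
From HB Require Import structures.
From mathcomp Require Import all_boot all_order all_algebra.
From mathcomp Require Import ring lra.
From mathcomp Require Import all_classical all_reals all_analysis.
From mathcomp Require Import measurable_realfun.
Set Implicit Arguments. Unset Strict Implicit. Unset Printing Implicit Defensive.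
Import Order.TTheory GRing.Theory Num.Theory.
Import numFieldNormedType.Exports.
Local Open Scope classical_set_scope.
Local Open Scope ring_scope.

(** * Real analysis and integration *)

(** The constant 2 comes from the range of the loss: [DeltaL] lies in [[-1, 1]], so the sign makes
    it a symmetric coin with values [c] and [-c], [|c| <= 1], whose exponential moment [cosh (t c)]
    is at most [exp (t^2 / 2)]; the maximum over [t] of [t h - t^2 / 2] is [h^2 / 2], reached at
    [t = h]. Two obstacles shape the rest. [KL] picks a density by choice and nothing is established
    about the measurability of [dis_MI] in the supersample; so the lower bound on [KL] is proved for
    an arbitrary density, and outer integrals of [dis_MI] are handled only as suprema over simple
    functions. Moreover [Zt_iid] and [joint_law] describe laws on boxes and rectangles only; using
    them under an integral sign takes uniqueness of finite measures on a generating class stable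
    under intersection. *)

Lemma leq_expn2_fact_double k : (2 ^ k * k`! <= k.*2`!)%N.
Proof.
elim: k => // k IH; rewrite doubleS !factS expnS.
(* From [k] to [k + 1] the left side gains the factor [2 (k + 1)], the right side
   [(2k + 2)(2k + 1)]. *)
rewrite (_ : 2 * 2 ^ k * (k.+1 * k`!) = k.+1.*2 * (2 ^ k * k`!))%N; last first.
  by rewrite -mul2n; ring.
rewrite [leqRHS](_ : _ = k.+1.*2 * (k.*2.+1 * k.*2`!))%N; last by rewrite doubleS.
by rewrite leq_mul// (leq_trans IH)// leq_pmull.
Qed.

(* The coefficient of [x ^+ k.*2] is [1 / (2k)!] on the left and [1 / (2^k k!)] on the right. *)
Lemma cosh_le_gauss (R : realType) (x : R) :
  (expR x + expR (- x)) / 2 <= expR (x ^+ 2 / 2).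
Proof.
have cv (y : R) : series (exp_coeff y) n @[n --> \oo] --> expR y.
  exact: is_cvg_series_exp_coeff.
(* Only partial sums with an even number of terms are compared: going from [n] to [n + 1] adds the
   degrees [2n] and [2n + 1], and the odd one cancels between [x] and [- x]. *)
have c2 (y : R) : series (exp_coeff y) n.*2 @[n --> \oo] --> expR y.
  apply: cvg_comp (cv y); apply/cvgnyPge => A.
  by exists A => // n /= An; rewrite (leq_trans An)// -addnn leq_addr.
have cc : (series (exp_coeff x) n.*2 + series (exp_coeff (- x)) n.*2) / 2
    @[n --> \oo] --> (expR x + expR (- x)) / 2.
  by apply: cvgMr_tmp; apply: cvgD; apply: c2.
apply: (ler_cvg_to cc (cv _)); apply: nearW; elim=> [|n IH].
  by rewrite /series/= !big_geq// addr0 mul0r.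
rewrite doubleS {1 2}/series /= !big_nat_recr//= -!/(series _ _).
have -> : exp_coeff (- x) n.*2 = exp_coeff x n.*2.
  by rewrite /exp_coeff/= exprNn -signr_odd odd_double mul1r.
have -> : exp_coeff (- x) n.*2.+1 = - exp_coeff x n.*2.+1.
  by rewrite /exp_coeff/= exprNn -signr_odd/= odd_double mulN1r mulNr.
rewrite [X in _ <= X](_ : _ = series (exp_coeff (x ^+ 2 / 2)) n +
  exp_coeff (x ^+ 2 / 2) n); last by rewrite /series /= big_nat_recr.
rewrite [leLHS](_ : _ = (series (exp_coeff x) n.*2 +
  series (exp_coeff (- x)) n.*2) / 2 + exp_coeff x n.*2); last first.
  rewrite /series /=; move: (\sum_(_ <= i < _) exp_coeff x i) => a.
  by move: (\sum_(_ <= i < _) _) (exp_coeff x _) (exp_coeff x _) => b c e; field.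
apply: lerD => //.
rewrite /exp_coeff/= expr_div_n -exprM mul2n -mulrA ler_wpM2l//.
  by rewrite -mul2n exprM exprn_ge0// sqr_ge0.
rewrite -invfM lef_pV2 ?posrE ?mulr_gt0 ?exprn_gt0 ?ltr0n ?fact_gt0//.
by rewrite -natrX -natrM ler_nat leq_expn2_fact_double.
Qed.

Section lower_integral.
Context d (T : measurableType d) (R : realType).
Local Open Scope ereal_scope.
Import HBNNSimple.

(* The integral of a nonnegative function is a supremum over the simple functions
   below it, even for a possibly nonmeasurable [g] like the disintegrated mutual
   information. *)
Lemma ge0_le_integral_lower (m : {measure set T -> \bar R}) (f g : T -> \bar R) :
  (forall x, 0 <= f x) -> (forall x, f x <= g x) ->
  \int[m]_x f x <= \int[m]_x g x.
Proof.
move=> f0 fg; rewrite !ge0_integralTE//; last first.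
  by move=> x; exact: le_trans (fg x).
apply: ereal_sup_le => _ [h hf <-].
by exists h => // x; exact: le_trans (hf x) (fg x).
Qed.

(** This is nonnegativity of the variance. A finite second moment bounds the first one through
    [h <= h^2 + 1]. *)
Lemma nnsfun_integral_sqr (P : probability T R) (h : {nnsfun T >-> R}) :
  (\int[P]_x (h x)%:E) ^+ 2 <= \int[P]_x (h x ^+ 2)%:E.
Proof.
have mh : measurable_fun setT (fun x => (h x)%:E) by exact/measurable_EFinP.
have mh2 : measurable_fun setT (fun x => (h x ^+ 2)%:E).
  exact/measurable_EFinP/measurable_funX.
have h2_ge0 (x : T) : 0 <= (h x ^+ 2)%:E by rewrite lee_fin sqr_ge0.
have intc (c : R) : \int[P]_x c%:E = c%:E.
  by rewrite integral_cst//= probability_setT mule1.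
have [->|h2_neqy] := eqVneq (\int[P]_x (h x ^+ 2)%:E) +oo; first by rewrite leey.
have h2_ltey : \int[P]_x (h x ^+ 2)%:E < +oo by rewrite ltey.
have h_ltey : \int[P]_x (h x)%:E < +oo.
  apply: (@le_lt_trans _ _ (\int[P]_x ((h x ^+ 2)%:E + 1))).
    apply: ge0_le_integral => //; [by move=> x _; rewrite lee_fin| |].
      exact: emeasurable_funD.
    by move=> x _; rewrite -EFinD lee_fin; nra.
  by rewrite ge0_integralD// intc lte_add_pinfty// ltry.
have h_ge0 : 0 <= \int[P]_x (h x)%:E by apply: integral_ge0 => x _; rewrite lee_fin.
have h_fin : \int[P]_x (h x)%:E \is a fin_num by rewrite ge0_fin_numE.
have h2_fin : \int[P]_x (h x ^+ 2)%:E \is a fin_num.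
  by rewrite ge0_fin_numE// integral_ge0.
set m := fine (\int[P]_x (h x)%:E).
have hm : \int[P]_x (h x)%:E = m%:E by rewrite fineK.
have m_ge0 : (0 <= m)%R by rewrite -lee_fin -hm.
(* The inequality [(h - m)^2 >= 0], with [m] the mean, is arranged so that both sides are
   nonnegative and can be integrated without subtraction. *)
have : \int[P]_x ((m *+ 2)%:E * (h x)%:E) <= \int[P]_x ((h x ^+ 2)%:E + (m ^+ 2)%:E).
  apply: ge0_le_integral => //.
  - by move=> x _; rewrite -EFinM lee_fin mulr_ge0// mulrn_wge0.
  - exact: emeasurable_funM.
  - by apply: emeasurable_funD.
  - move=> x _; rewrite -EFinM -EFinD lee_fin.
    by have := sqr_ge0 (h x - m)%R; nra.
rewrite ge0_integralZl//; last 2 first.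
  - by move=> x _; rewrite lee_fin.
  - by rewrite lee_fin mulrn_wge0.
rewrite ge0_integralD//; last by move=> x _; rewrite lee_fin sqr_ge0.
rewrite intc hm -(fineK h2_fin) -EFinM -EFinD -EFin_expe !lee_fin; nra.
Qed.

(* Jensen's inequality for lower integrals: it is enough to treat the simple
   functions below [sqrte (r%:E * f x)]. *)
Lemma integral_sqrte_le (P : probability T R) (f : T -> \bar R) (r : R) :
  (0 < r)%R -> (forall x, 0 <= f x) ->
  \int[P]_x sqrte (r%:E * f x) <= sqrte (r%:E * \int[P]_x f x).
Proof.
move=> r0 f0.
rewrite ge0_integralTE; last by move=> x; exact: sqrte_ge0.
apply: ge_ereal_sup => _ [h hf <-]; rewrite -integralT_nnsfun.
have h_ge0 : 0 <= \int[P]_x (h x)%:E by apply: integral_ge0 => x _; rewrite lee_fin.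
have f_ge0 : 0 <= r%:E * \int[P]_x f x.
  by apply: mule_ge0; [rewrite lee_fin ltW|exact: integral_ge0].
rewrite -[leLHS]gee0_abs// -sqrte_sqr lee_sqrt//.
apply: (le_trans (nnsfun_integral_sqr P h)).
(* The factor [r] is pulled out of the integral of the measurable function [h ^+ 2 / r]; passing
   from there to [f] takes only monotonicity. *)
rewrite (eq_integral (fun x => r%:E * (h x ^+ 2 / r)%:E)); last first.
  by move=> x _; rewrite -EFinM mulrCA divff ?mulr1// gt_eqF.
rewrite ge0_integralZl//; last 3 first.
  - by apply/measurable_EFinP; apply: measurable_funM => //; exact: measurable_funX.
  - by move=> x _; rewrite lee_fin divr_ge0 ?sqr_ge0 ?ltW.
  - by rewrite lee_fin ltW.
rewrite lee_pmul2l// ?lte_fin//; apply: ge0_le_integral_lower => x.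
  by rewrite lee_fin divr_ge0 ?sqr_ge0 ?ltW.
have := hf x; have := f0 x; case: (f x) => [y| |]//; rewrite ?leey//.
rewrite -EFinM /= !lee_fin => y0 hy.
rewrite ler_pdivrMr// mulrC -[leRHS]sqr_sqrtr ?mulr_ge0 ?(ltW r0)//.
by rewrite ler_sqr ?nnegrE ?sqrtr_ge0.
Qed.
End lower_integral.

(** * Change of measure and the Donsker-Varadhan lower bound *)

Section density.
Context d (T : measurableType d) (R : realType).
Local Open Scope ereal_scope.
Import HBNNSimple.

(** A density is defined by its action on sets. Linearity extends the identity to simple functions,
    level set by level set, and monotone convergence to nonnegative measurable functions. *)
Lemma integral_density (P Q : {measure set T -> \bar R}) (f : T -> R)
    (g : T -> \bar R) : is_density P Q f ->
  (forall x, 0 <= g x) -> measurable_fun setT g ->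
  \int[P]_x g x = \int[Q]_x (g x * (f x)%:E).
Proof.
move=> [mf f0 PE] g0 mg; pose h := nnsfun_approx measurableT mg.
have mEf : measurable_fun setT (EFin \o f) by exact/measurable_EFinP.
have hg (x : T) : (EFin \o h n) x @[n --> \oo] --> g x.
  by apply: cvg_nnsfun_approx.
transitivity (limn (fun n => \int[P]_x (h n x)%:E)).
  rewrite -monotone_convergence//.
  - by apply: eq_integral => x _; apply/esym/cvg_lim => //; exact: hg.
  - by move=> n; exact/measurable_EFinP.
  - by move=> n x _; rewrite lee_fin.
  - by move=> x _ a b ab; rewrite lee_fin; exact/lefP/nd_nnsfun_approx.
transitivity (limn (fun n => \int[Q]_x ((h n x)%:E * (f x)%:E))); last first.
  rewrite -monotone_convergence//.
  - apply: eq_integral => x _; apply/cvg_lim => //.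
    by apply: cvgeZr => //; exact: hg.
  - by move=> n; apply: emeasurable_funM => //; exact/measurable_EFinP.
  - by move=> n x _; rewrite mule_ge0 ?lee_fin.
  - by move=> x _ a b ab; rewrite lee_wpmul2r ?lee_fin//; exact/lefP/nd_nnsfun_approx.
congr (limn _); apply/funext => n.
transitivity (\int[P]_x (\sum_(y \in range (h n)) (y * \1_(h n @^-1` [set y]) x)%:E)).
  by apply: eq_integral => t _; rewrite /= fimfunE -fsumEFin.
have mind r : measurable_fun setT (fun x => (r * \1_(h n @^-1` [set r]) x)%:E).
  by apply: (measurable_comp measurableT) => //; exact: measurable_funM.
rewrite ge0_integral_fsum//; last by move=> y x _; exact: nnfun_muleindic_ge0.
transitivity (\int[Q]_x (\sum_(y \in range (h n))
    (y * \1_(h n @^-1` [set y]) x)%:E * (f x)%:E)); last first.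
  apply: eq_integral => x _.
  rewrite -ge0_mule_fsuml => [|y]; last exact: nnfun_muleindic_ge0.
  by rewrite fsumEFin // -(fimfunE _ x).
rewrite ge0_integral_fsum//; last 2 first.
  - by move=> y; exact: emeasurable_funM.
  - by move=> y x _; rewrite mule_ge0 ?lee_fin// -lee_fin nnfun_muleindic_ge0.
apply: eq_fsbigr => r rhn.
under [LHS]eq_integral do rewrite EFinM.
rewrite integralZl_indic_nnsfun//.
under [RHS]eq_integral do rewrite EFinM -muleA.
rewrite [RHS]ge0_integralZl//.
- under [in RHS]eq_integral do rewrite muleC.
  rewrite [in RHS](eq_integral ((EFin \o f) \_ (h n @^-1` [set r]))); last first.
    by move=> x xE; rewrite epatch_indic.
  by rewrite -integral_mkcond -PE// integral_indic// setIT.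
- by apply: emeasurable_funM => //; exact/measurable_EFinP.
- by move=> t _; rewrite mule_ge0 ?lee_fin.
- by move: rhn; rewrite inE => -[t _ <-]; rewrite lee_fin.
Qed.

(* The easy half of the Donsker-Varadhan formula. It rests on the pointwise
   inequality [b - C + 1 - expR (b - C - ln f) <= ln f]; since [ln 0 = 0], it
   also holds where the density [f] vanishes. *)
Lemma le_KL (P : probability T R) (Q : {measure set T -> \bar R}) (b : T -> R) (C : R) :
  measurable_fun setT b -> (forall x, 0 <= b x)%R -> (exists M, forall x, b x <= M)%R ->
  \int[Q]_x (expR (b x))%:E <= (expR C)%:E ->
  \int[P]_x (b x)%:E - C%:E <= KL P Q.
Proof.
move=> mb b0 [M bM] Qb; rewrite /KL; case: pselect => [H|_]; last by rewrite leey.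
case: (cid H) => f /= fd; case: (fd) => mf f0 PE.
pose g x := expR (b x - C - ln (f x)).
have mg : measurable_fun setT g.
  apply: measurableT_comp => //; apply: measurable_funB; first exact: measurable_funB.
  exact: measurableT_comp.
have g0 x : (0 <= g x)%R by rewrite expR_ge0.
(* Under [Q] the density cancels: [g x * f x] is [expR (b x - C)] where [f x] is positive and [0]
   where it vanishes. *)
have intg : \int[P]_x (g x)%:E <= 1.
  rewrite (integral_density fd)//; last exact/measurable_EFinP.
  apply: (@le_trans _ _ (\int[Q]_x ((expR (- C))%:E * (expR (b x))%:E))).
    apply: ge0_le_integral => //.
    - by move=> x _; rewrite mule_ge0 ?lee_fin.
    - by apply: emeasurable_funM; exact/measurable_EFinP.
    - by apply: emeasurable_funM => //; apply/measurable_EFinP; exact: measurableT_comp.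
    - move=> x _; rewrite -!EFinM lee_fin /g.
      have [->|fx] := eqVneq (f x) 0%R; first by rewrite mulr0 mulr_ge0 ?expR_ge0.
      rewrite expRB lnK ?posrE; last by rewrite lt_neqAle eq_sym fx f0.
      by rewrite divfK// -expRD addrC.
  rewrite ge0_integralZl//; last by apply/measurable_EFinP; exact: measurableT_comp.
  apply: (@le_trans _ _ ((expR (- C))%:E * (expR C)%:E)).
    by rewrite lee_pmul2l// lte_fin expR_gt0.
  by rewrite -EFinM -expRD addNr expR0.
(* An integrable minorant of [ln f]: since [g] integrates to at most [1], its integral is at least
   that of [b] minus [C]. *)
pose psi x := (b x + (1 - C) - g x)%R.
have psi_le x : (psi x <= ln (f x))%R.
  by rewrite /psi /g; have := expR_ge1Dx (b x - C - ln (f x))%R; lra.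
have bi : P.-integrable setT (EFin \o b).
  apply: measurable_bounded_integrable => //.
    by rewrite (le_lt_trans (probability_le1 P _))// ltry.
  exists M; split; first exact: num_real.
  by move=> y My x _ /=; rewrite ger0_norm// (le_trans (bM x))// ltW.
have ci : P.-integrable setT (EFin \o cst (1 - C)%R).
  by apply: finite_measure_integrable_cst.
have gi : P.-integrable setT (EFin \o g).
  apply/integrableP; split; first exact/measurable_EFinP.
  rewrite (eq_integral (fun x => (g x)%:E)).
    by rewrite (le_lt_trans intg)// ltry.
  by move=> x _; rewrite /= ger0_norm.
apply: (@le_trans _ _ (\int[P]_x (psi x)%:E)).
  have bci : P.-integrable setT (EFin \o (fun x => b x + cst (1 - C) x)%R).
    by apply: (integrableD measurableT bi ci).
  rewrite (integralB_EFin measurableT bci gi) (integralD_EFin measurableT bi ci).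
  rewrite [X in _ + X - _](_ : _ = (1 - C)%:E); last first.
    by rewrite -[LHS]/(\int[P]_x (cst (1 - C)%:E x)) integral_cst//= probability_setT mule1.
  have bf : \int[P]_x (b x)%:E \is a fin_num by apply: integrable_fin_num.
  have gf : \int[P]_x (g x)%:E \is a fin_num by apply: integrable_fin_num.
  move: intg; rewrite -(fineK bf) -(fineK gf) -EFinN -!EFinD !lee_fin.
  by move=> ?; lra.
have mpsi : measurable_fun setT psi.
  apply: measurable_funB => //; exact: measurable_funD.
have mln : measurable_fun setT (fun x => ln (f x)) by exact: measurableT_comp.
(* Integrability of [ln f] is not known, so positive and negative parts are compared separately. *)
rewrite [leLHS]integralE [leRHS]integralE; apply: leeB; apply: ge0_le_integral => //.
- exact/measurable_funepos/measurable_EFinP.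
- exact/measurable_funepos/measurable_EFinP.
- by move=> x _; apply: (@funepos_le _ _ setT) => [t _|]; rewrite ?lee_fin ?in_setT.
- exact/measurable_funeneg/measurable_EFinP.
- exact/measurable_funeneg/measurable_EFinP.
- by move=> x _; apply: (@funeneg_le _ _ setT) => [t _|]; rewrite ?lee_fin ?in_setT.
Qed.
End density.

(** * A lower bound on mutual information *)

Section image_measure.
Context d1 d2 (T1 : measurableType d1) (T2 : measurableType d2) (R : realType).
Variables (f : T1 -> T2) (mf : measurable_fun setT f).

Definition image_measure (m : {measure set T1 -> \bar R}) : {measure set T2 -> \bar R} :=
  measure_function_pushforward__canonical__measure_function_Measure m mf.

Let imf := isMeasurableFun.Build _ _ _ _ f mf.
Definition image_probability (P : probability T1 R) : probability T2 R :=
  distribution P (HB.pack f imf : {mfun T1 >-> T2}).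

End image_measure.

Section mutual_information.
Context (R : realType).

Lemma ge0_integral_fair_bool (m : {measure set bool -> \bar R}) (f : bool -> \bar R) :
  (forall y, m [set y] = (2^-1)%:E) -> (forall y, 0 <= f y)%E ->
  (\int[m]_y f y = f true * (2^-1)%:E + f false * (2^-1)%:E)%E.
Proof.
move=> mhalf f0.
rewrite (eq_integral (fun y => f true * (\1_[set true] y)%:E +
                               f false * (\1_[set false] y)%:E)%E); last first.
  by move=> [] _; rewrite !indicE !in_set1 /= ?mule1 ?mule0 ?adde0 ?add0e.
rewrite ge0_integralD//; last 2 first.
  - by move=> y _; rewrite mule_ge0.
  - by move=> y _; rewrite mule_ge0.
by rewrite !ge0_integralZl// !integral_indic// !setIT !mhalf.
Qed.

(* The joint law lives on the whole line: clipping the loss difference makes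
   the exponential tilt bounded. *)
Definition clip (x : R) : R := Num.max (-1) (Num.min 1 x).

Lemma measurable_clip : measurable_fun setT clip.
Proof. by apply: measurable_maxr => //; apply: measurable_minr. Qed.

Lemma clip_norm_le1 x : `|clip x| <= 1.
Proof. by rewrite ler_norml /clip le_max lexx ge_max ge_min lexx /= andbT; lra. Qed.

Lemma clip_id x : `|x| <= 1 -> clip x = x.
Proof. by rewrite ler_norml => /andP[? ?]; rewrite /clip min_r// max_r. Qed.

(* The summand [`|t|] only serves to make the function nonnegative. *)
Definition tilt (t : R) (p : R * bool) : R := t * ((-1) ^+ p.2 * clip p.1) + `|t|.

Lemma measurable_tilt t : measurable_fun setT (tilt t).
Proof.
apply: measurable_funD => //; apply: measurable_funM => //.
apply: measurable_funM.
  apply: (@measurableT_comp _ _ _ _ _ _ (fun b : bool => (-1) ^+ b : R)) => //.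
exact: measurableT_comp measurable_clip _.
Qed.

Lemma tilt_ge0 t p : 0 <= tilt t p.
Proof.
rewrite /tilt -lerBlDr sub0r lerNl -mulrN.
rewrite (le_trans (ler_norm _))// normrM normrN normrM normrX normrN1 expr1n mul1r.
by rewrite ler_piMr// clip_norm_le1.
Qed.

Lemma tilt_le t p : tilt t p <= `|t| + `|t|.
Proof.
rewrite /tilt lerD2r (le_trans (ler_norm _))// normrM normrM normrX normrN1 expr1n mul1r.
by rewrite ler_piMr// clip_norm_le1.
Qed.

(* Under the product of the marginals the sign is a fair coin independent of
   the first component, so the tilt integrates to a hyperbolic cosine. *)
Lemma le_mutual_info (J : probability (R * bool)%type R) (t : R) :
  (forall y : bool, J (setT `*` [set y]) = (2^-1)%:E) ->
  (\int[J]_p (tilt t p)%:E - (`|t| + t ^+ 2 / 2)%:E <= mutual_info J)%E.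
Proof.
move=> Jhalf.
(* [mutual_info] multiplies bare set functions; recognizing them as image probabilities makes
   Tonelli's theorem available. *)
pose M1 := image_probability measurable_fst J.
pose M2 := image_probability measurable_snd J.
have M1E : (fun B => J (B `*` setT)) = M1 :> (set R -> \bar R).
  by apply/funext => B; rewrite setXT.
have M2E : (fun B => J (setT `*` B)) = M2 :> (set bool -> \bar R).
  by apply/funext => B; rewrite setTX.
have -> : mutual_info J = KL J (M1 \x M2)%E by rewrite /mutual_info M1E M2E.
have mt := measurable_tilt t.
have met : measurable_fun setT (fun p => (expR (tilt t p))%:E).
  by apply/measurable_EFinP; exact: measurableT_comp.
(* Here [C] is [|t| + t^2 / 2]: the shift built into [tilt] plus the Gaussian exponent. *)
apply: le_KL => //.
- exact: tilt_ge0.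
- by exists (`|t| + `|t|) => p; exact: tilt_le.
rewrite fubini_tonelli1//.
apply: (@le_trans _ _ (\int[M1]_x (expR (`|t| + t ^+ 2 / 2))%:E)%E); last first.
  by rewrite integral_cst//= probability_setT mule1.
apply: ge0_le_integral => //.
- by move=> x _; apply: integral_ge0 => y _; rewrite lee_fin expR_ge0.
- by apply: measurable_fun_fubini_tonelli_F => // p; rewrite lee_fin expR_ge0.
have M2half y : M2 [set y] = (2^-1)%:E by rewrite -(Jhalf y) setTX.
move=> x _; rewrite /fubini_F (ge0_integral_fair_bool M2half)//.
rewrite -!EFinM -EFinD lee_fin /tilt/= expr0 expr1 mul1r mulN1r.
set c := clip x; have : `|c| <= 1 by exact: clip_norm_le1.
rewrite ler_norml => /andP[c1 c2].
rewrite !expRD mulrN (_ : _ + _ = expR `|t| * ((expR (t * c) + expR (- (t * c))) / 2)); last ring.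
rewrite ler_wpM2l ?expR_ge0// (le_trans (cosh_le_gauss _))// ler_expR.
by rewrite ler_wpM2r// exprMn ler_piMr ?sqr_ge0// expr2; nra.
Qed.

End mutual_information.

(** * The conditional law of the loss difference *)

Lemma integrable01 d (T : measurableType d) (R : realType) (P : probability T R)
    (f : T -> R) : measurable_fun setT f -> (forall x, 0 <= f x <= 1) ->
  P.-integrable setT (EFin \o f).
Proof.
move=> mf f01; apply: measurable_bounded_integrable => //.
  by rewrite (le_lt_trans (probability_le1 P _))// ltry.
exists 1; split; first exact: num_real.
move=> y y1 x _ /=; have /andP[f0 f1] := f01 x.
by rewrite ger0_norm// (le_trans f1)// ltW.
Qed.

Section supersample.
Context (R : realType) (n : nat) (dZ dW : measure_display)
  (Z : measurableType dZ) (W : measurableType dW)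
  (A : R.-pker (n.-tuple Z) ~> W) (loss : W -> Z -> R)
  (loss_meas : measurable_fun setT (fun p : W * Z => loss p.1 p.2))
  (loss01 : forall w z, 0 <= loss w z <= 1).

Definition mean (x : n.-tuple bool -> R) : R := (2%:R ^+ n)^-1 * \sum_u x u.

Lemma mean_cst (a : R) : mean (fun=> a) = a.
Proof.
by rewrite /mean sumr_const card_tuple card_bool -[a *+ _]mulr_natl natrX mulKf//.
Qed.

Lemma le_mean (x y : n.-tuple bool -> R) : (forall u, x u <= y u) -> mean x <= mean y.
Proof. by move=> xy; rewrite /mean ler_wpM2l ?invr_ge0 ?exprn_ge0// ler_sum. Qed.

Lemma meanB (x y : n.-tuple bool -> R) : mean (fun u => x u - y u) = mean x - mean y.
Proof. by rewrite /mean sumrB mulrBr. Qed.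

Lemma mean_affine (t a : R) (x : n.-tuple bool -> R) :
  mean (fun u => t * x u + a) = t * mean x + a.
Proof. by rewrite -[in RHS](mean_cst a) /mean big_split/= -mulr_sumr mulrDr mulrCA. Qed.

Definition flip (i : 'I_n) (u : n.-tuple bool) : n.-tuple bool :=
  [tuple if j == i then ~~ tnth u j else tnth u j | j < n].

Lemma flipK i : involutive (flip i).
Proof.
move=> u; apply: eq_from_tnth => j; rewrite !tnth_mktuple.
by case: eqP; rewrite ?negbK.
Qed.

(** Flipping the [i]-th bit is a bijection of the label vectors that exchanges the two events, whose
    indicators sum to [1]. *)
Lemma mean_label (i : 'I_n) (y : bool) : mean (fun u => (tnth u i == y)%:R) = 2^-1.
Proof.
have e : mean (fun u => (tnth u i == y)%:R) = mean (fun u => (tnth u i == ~~ y)%:R).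
  rewrite /mean (reindex_inj (inv_inj (flipK i))); congr (_ * _).
  by apply: eq_bigr => u _; rewrite tnth_mktuple eqxx; case: (tnth u i) (y) => -[].
have : mean (fun u => (tnth u i == y)%:R) + mean (fun u => (tnth u i == ~~ y)%:R) = 1.
  rewrite -[RHS](mean_cst 1) /mean -mulrDr -big_split/=; congr (_ * _).
  by apply: eq_bigr => u _; case: (tnth u i) (y) => -[]; rewrite /= ?addr0 ?add0r.
by rewrite -e; lra.
Qed.

Lemma measurable_loss_l z : measurable_fun setT (loss ^~ z).
Proof. exact: (measurableT_comp loss_meas (measurable_fun_pair _ _)). Qed.

Lemma integrable_loss (P : probability W R) z :
  P.-integrable setT (EFin \o (loss ^~ z)).
Proof. by apply: integrable01 => //; exact: measurable_loss_l. Qed.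

(* An alias of [A s] carrying a probability structure. *)
Definition law (s : n.-tuple Z) : set W -> \bar R := A s.
HB.instance Definition _ s := Measure.on (law s).
HB.instance Definition _ s :=
  Measure_isProbability.Build _ _ _ (law s) (@prob_kernel _ _ _ _ _ A s).

Definition risk (s : n.-tuple Z) (z : Z) : R := fine (\int[A s]_w (loss w z)%:E).

Lemma integral_lossE s z : (\int[A s]_w (loss w z)%:E = (risk s z)%:E)%E.
Proof. by rewrite /risk fineK//; exact: (integrable_fin_num measurableT (integrable_loss (law s) z)). Qed.

(** This is the form that [tilt] takes at [DeltaL] once the sign has been absorbed. *)
Lemma integral_loss_affine s z1 z2 (t a : R) :
  (\int[A s]_w (t * (loss w z1 - loss w z2) + a)%:E =
   (t * (risk s z1 - risk s z2) + a)%:E)%E.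
Proof.
have i1 := integrable_loss (law s) z1; have i2 := integrable_loss (law s) z2.
have iB : (law s).-integrable setT (EFin \o (fun w => loss w z1 - loss w z2)).
  exact: (integrableB measurableT i1 i2).
have iZ : (law s).-integrable setT (EFin \o (fun w => t * (loss w z1 - loss w z2))).
  exact: (integrableZl measurableT t iB).
have ia : (law s).-integrable setT (EFin \o cst a) by exact: finite_measure_integrable_cst.
rewrite (integralD_EFin measurableT iZ ia) -[X in (_ + X)%E]/(\int[law s]_w (cst a%:E w))%E.
rewrite integral_cst//= probability_setT mule1.
rewrite (integralZl measurableT iB) (integralB_EFin measurableT i1 i2).
by rewrite !integral_lossE.
Qed.

Lemma risk01 s z : 0 <= risk s z <= 1.
Proof.
rewrite -!lee_fin -integral_lossE; apply/andP; split.
  by apply: integral_ge0 => w _; rewrite lee_fin; have /andP[] := loss01 w z.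
apply: (@le_trans _ _ (\int[law s]_w 1)%E).
  apply: ge0_le_integral => //.
  - by move=> w _; rewrite lee_fin; have /andP[] := loss01 w z.
  - exact/measurable_EFinP/measurable_loss_l.
  - by move=> w _; rewrite lee_fin; have /andP[] := loss01 w z.
by rewrite integral_cst//= probability_setT mule1.
Qed.

Definition ghost (zt : n.-tuple (Z * Z)) (u : n.-tuple bool) (i : 'I_n) : Z :=
  if tnth u i then (tnth zt i).1 else (tnth zt i).2.

(** [DeltaL] is always second minus first; when the label selects the second point, this is training
    minus ghost, and the sign turns it around. *)
Lemma DeltaL_sign zt (u : n.-tuple bool) i w :
  (-1) ^+ tnth u i * DeltaL loss zt i w =
  loss w (ghost zt u i) - loss w (tnth (select zt u) i).
Proof.
rewrite /DeltaL /ghost /select tnth_mktuple; case: (tnth u i).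
  by rewrite expr1 mulN1r opprB.
by rewrite expr0 mul1r.
Qed.

(* The conditional expectation of [(-1) ^+ U_i * DeltaL_i] given the supersample. *)
Definition gap (zt : n.-tuple (Z * Z)) (i : 'I_n) : R :=
  mean (fun u => risk (select zt u) (ghost zt u i) -
                 risk (select zt u) (tnth (select zt u) i)).

Section joint.
Variables (zt : n.-tuple (Z * Z)) (i : 'I_n).

Lemma measurable_DeltaL : measurable_fun setT (DeltaL loss zt i).
Proof. by apply: measurable_funB; exact: measurable_loss_l. Qed.

Lemma DeltaL_norm_le1 w : `|DeltaL loss zt i w| <= 1.
Proof.
rewrite /DeltaL ler_norml.
have /andP[? ?] := loss01 w (tnth zt i).1; have /andP[? ?] := loss01 w (tnth zt i).2.
by apply/andP; split; lra.
Qed.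

Lemma measurable_DeltaL_label (u : n.-tuple bool) :
  measurable_fun setT (fun w => (DeltaL loss zt i w, tnth u i)).
Proof. by apply: measurable_fun_pair => //; exact: measurable_DeltaL. Qed.

Let bits := enum {: n.-tuple bool}.
Let u0 : n.-tuple bool := [tuple false | _ < n].
Let weight_ge0 : 0 <= (2%:R ^+ n)^-1 :> R.
Proof. by rewrite invr_ge0 exprn_ge0. Qed.

(** [msum] adds a sequence of measures indexed by naturals, hence the enumeration of the label
    vectors; [u0] is only the default value of [nth], never reached below [size bits]. *)
Let part (k : nat) : {measure set (R * bool) -> \bar R} :=
  image_measure (measurable_DeltaL_label (nth u0 bits k)) (A (select zt (nth u0 bits k))).

(** Rebuilds [cond_joint], a bare set function, from operations on measures so that it inherits a
    measure structure; [jointE] identifies the two. *)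
Definition joint : set (R * bool) -> \bar R :=
  mscale (NngNum weight_ge0) (msum part (size bits)).
HB.instance Definition _ := Measure.on joint.

Let sum_bits (F : n.-tuple bool -> \bar R) :
  (\sum_(k < size bits) F (nth u0 bits k) = \sum_u F u)%E.
Proof.
rewrite [RHS](_ : _ = \sum_(u <- bits) F u)%E; last by rewrite big_enum.
by rewrite (big_nth u0) big_mkord.
Qed.

Lemma jointE : joint = cond_joint A loss zt i.
Proof.
apply/funext => E; rewrite /joint /mscale /= /msum /cond_joint -sum_bits.
by [].
Qed.

Lemma integral_joint (f : R * bool -> R) :
  measurable_fun setT f -> (forall p, 0 <= f p) ->
  (\int[joint]_p (f p)%:E = ((2%:R ^+ n)^-1)%:E *
    \sum_u \int[A (select zt u)]_w (f (DeltaL loss zt i w, tnth u i))%:E)%E.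
Proof.
move=> mf f0; have mEf : measurable_fun setT (EFin \o f) by exact/measurable_EFinP.
rewrite ge0_integral_mscale//; last by move=> p _; rewrite lee_fin.
rewrite ge0_integral_measure_sum//; last by move=> p _; rewrite lee_fin.
rewrite -sum_bits; congr (_ * _)%E; apply: eq_bigr => k _.
rewrite ge0_integral_pushforward//; first exact: measurable_DeltaL_label.
by move=> p _; rewrite lee_fin.
Qed.

Let joint_setT : joint setT = 1%E.
Proof.
rewrite jointE /cond_joint (eq_bigr (fun=> 1%E)); last first.
  by move=> u _; rewrite (_ : [set w | _] = setT)// prob_kernel.
by rewrite -[RHS]/(1%:E) -[in RHS](mean_cst 1) (sumEFin _ _ (fun=> 1)) -EFinM.
Qed.

HB.instance Definition _ := Measure_isProbability.Build _ _ _ joint joint_setT.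

Lemma joint_label (y : bool) : joint (setT `*` [set y]) = (2^-1)%:E.
Proof.
rewrite jointE /cond_joint (eq_bigr (fun u => ((tnth u i == y)%:R)%:E)); last first.
  move=> u _; have [uy|uy] := eqVneq (tnth u i) y.
    by rewrite (_ : [set w | _] = setT) ?prob_kernel//; apply/seteqP; split.
  rewrite (_ : [set w | _] = set0) ?measure0//; apply/seteqP; split => // w [_ /= e].
  by move: uy; rewrite e eqxx.
rewrite sumEFin -EFinM -/(mean _); by rewrite mean_label.
Qed.

Lemma le_dis_MI : (((gap zt i) ^+ 2 / 2)%:E <= dis_MI A loss zt i)%E.
Proof.
set t := gap zt i.
have := @le_mutual_info R joint t joint_label.
rewrite /dis_MI -jointE; apply: le_trans.
rewrite integral_joint; [|exact: measurable_tilt|exact: tilt_ge0].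
rewrite (eq_bigr (fun u => (t * (risk (select zt u) (ghost zt u i) -
    risk (select zt u) (tnth (select zt u) i)) + `|t|)%:E)); last first.
  move=> u _.
  (* Clipping is inactive because [|DeltaL| <= 1]. *)
  under eq_integral => w _.
    rewrite /tilt /= clip_id ?DeltaL_norm_le1// DeltaL_sign.
    over.
  exact: integral_loss_affine.
rewrite sumEFin -EFinM -EFinB lee_fin -/(mean _) mean_affine -/(gap zt i) -/t.
by lra.
Qed.

End joint.
End supersample.

(** * Transport to the sample space *)

Section restriction.
Context d (T : measurableType d) (R : realType).
Local Open Scope ereal_scope.

(** The indicator of [D] is a density of the restriction with respect to [m]. *)
Lemma ge0_integral_mrestr (m : {measure set T -> \bar R}) (D : set T)
    (mD : measurable D) (f : T -> \bar R) :
  measurable_fun setT f -> (forall x, 0 <= f x) ->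
  \int[mrestr m mD]_x f x = \int[m]_x (f \_ D) x.
Proof.
move=> mf f0; rewrite [LHS](@integral_density _ _ _ (mrestr m mD) m \1_D)//; last first.
  by split => // B mB; rewrite integral_indic// setIC.
by apply: eq_integral => x _; rewrite epatch_indic.
Qed.

End restriction.

(** * Uniqueness of finite measures on rectangles and boxes *)

Section product_measures_eq.
Context d1 d2 (T1 : measurableType d1) (T2 : measurableType d2) (R : realType).
Local Open Scope ereal_scope.

Lemma eq_measure_rectangles (m1 m2 : {measure set (T1 * T2) -> \bar R}) :
  m1 setT < +oo ->
  (forall A B, measurable A -> measurable B -> m1 (A `*` B) = m2 (A `*` B)) ->
  forall E, measurable E -> m1 E = m2 E.
Proof.
move=> m1oo m12 E mE.
apply: (measure_unique [set A `*` B | A in measurable & B in measurable] (fun=> setT)) => //.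
- exact: measurable_prod_measurableType.
- move=> _ _ [A1 mA1 [B1 mB1 <-]] [A2 mA2 [B2 mB2 <-]].
  exists (A1 `&` A2); first exact: measurableI.
  by exists (B1 `&` B2); [exact: measurableI|rewrite setXI].
- by move=> _; exists setT => //; exists setT => //; rewrite setXTT.
- by rewrite bigcup_const//; exists 0%N.
- by move=> _ [A mA [B mB <-]]; exact: m12.
Qed.

End product_measures_eq.

Section tuple_measures_eq.
Context d (T : measurableType d) (n : nat) (R : realType).
Local Open Scope ereal_scope.

Definition box (B : 'I_n -> set T) : set (n.-tuple T) :=
  [set t | forall i, B i (tnth t i)].

Lemma measurable_box (B : 'I_n -> set T) :
  (forall i, measurable (B i)) -> measurable (box B).
Proof.
move=> mB; rewrite (_ : box B = \big[setI/setT]_(i < n) ((@tnth n T ^~ i) @^-1` B i)).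
  apply: bigsetI_measurable => i _; rewrite -[X in measurable X]setTI.
  exact: measurable_tnth.
by rewrite -bigcap_seq; apply/seteqP; split => t /= Bt i; [move=> _|apply: Bt];
  rewrite /= ?mem_index_enum.
Qed.

Lemma eq_measure_boxes (m1 m2 : {measure set (n.-tuple T) -> \bar R}) :
  m1 setT < +oo ->
  (forall B, (forall i, measurable (B i)) -> m1 (box B) = m2 (box B)) ->
  forall E, measurable E -> m1 E = m2 E.
Proof.
move=> m1oo m12 E mE.
apply: (measure_unique [set box B | B in [set B | forall i, measurable (B i)]]
  (fun=> setT)) => //.
- apply/seteqP; split.
    apply: sub_smallest2r; first exact: smallest_sigma_algebra.
    rewrite -bigcup_seq => X [i _ [C mC <-]].
    (* The product sigma-algebra is generated by coordinate preimages, and each of them is a box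
       with a single nontrivial side. *)
    exists (fun j => if j == i then C else setT); first by move=> j /=; case: eqP.
    rewrite setTI; apply/seteqP; split => [t Bt|t Ct j /=].
      by have := Bt i; rewrite eqxx.
    by case: eqP => // ->.
  apply: smallest_sub; first exact: sigma_algebra_measurable.
  by move=> _ [B mB <-]; exact: measurable_box.
- move=> _ _ [B1 mB1 <-] [B2 mB2 <-].
  exists (fun i => B1 i `&` B2 i); first by move=> i; exact: measurableI.
  by apply/seteqP; split => [t B12|t [Bt1 Bt2] i];
    [split => i; have [] := B12 i|split].
- by move=> _; exists (fun=> setT) => //; apply/seteqP; split.
- by rewrite bigcup_const//; exists 0%N.
- by move=> _ [B mB <-]; exact: m12.
Qed.

End tuple_measures_eq.

Section kernel_pullback.
Context d d1 d2 (X : measurableType d) (Y : measurableType d1) (W : measurableType d2)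
  (R : realType) (k : R.-pker Y ~> W) (g : X -> Y).

(* As for [kdirac], the measurability proof is an argument so that the kernel
   structures can be inferred. *)
Definition kpull (mg : measurable_fun setT g) : X -> {measure set W -> \bar R} :=
  fun x => k (g x).

Hypothesis mg : measurable_fun setT g.

Let measurable_kpull B : measurable B -> measurable_fun setT (kpull mg ^~ B).
Proof. by move=> mB; exact: measurableT_comp (measurable_kernel k B mB) mg. Qed.

HB.instance Definition _ := isKernel.Build _ _ _ _ _ (kpull mg) measurable_kpull.

Let kpull_prob x : kpull mg x setT = 1%E.
Proof. exact: prob_kernel. Qed.

HB.instance Definition _ := Kernel_isProbability.Build _ _ _ _ _ (kpull mg) kpull_prob.

Lemma measurable_integral_kpull (f : X * W -> \bar R) :
  (forall p, 0 <= f p)%E -> measurable_fun setT f ->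
  measurable_fun setT (fun x => \int[k (g x)]_w f (x, w))%E.
Proof. by move=> f0 mf; exact: (measurable_fun_integral_finite_kernel f (kpull mg)). Qed.

(** The law of the pair [(x, w)] with [w] drawn from [k (g x)]: keeping [x] lets integrands depend
    on both the supersample and the hypothesis. *)
Definition kgraph (mg : measurable_fun setT g) : X -> {measure set (X * W) -> \bar R} :=
  fun x => image_measure (measurable_pair1 x) (kpull mg x).

Let measurable_kgraph B : measurable B -> measurable_fun setT (kgraph mg ^~ B).
Proof.
move=> mB; have := @measurable_fun_xsection_finite_kernel _ _ _ _ _ (kpull mg) B.
rewrite inE => /(_ mB); apply: eq_measurable_fun => x _.
by rewrite /kgraph /= /pushforward; congr (k _ _); rewrite xsectionE.
Qed.

HB.instance Definition _ := isKernel.Build _ _ _ _ _ (kgraph mg) measurable_kgraph.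

Let kgraph_prob x : kgraph mg x setT = 1%E.
Proof. exact: kpull_prob. Qed.

HB.instance Definition _ := Kernel_isProbability.Build _ _ _ _ _ (kgraph mg) kgraph_prob.

End kernel_pullback.

Section transport.
Context (R : realType) (n : nat) (dZ dW dO : measure_display)
  (Z : measurableType dZ) (W : measurableType dW) (Omega : measurableType dO)
  (A : R.-pker (n.-tuple Z) ~> W) (P : probability Omega R)
  (Zt : Omega -> n.-tuple (Z * Z)) (U : Omega -> n.-tuple bool) (Wh : Omega -> W)
  (mZt : measurable_fun setT Zt) (mU : measurable_fun setT U)
  (mWh : measurable_fun setT Wh).

Lemma measurable_select (u : n.-tuple bool) :
  measurable_fun setT (fun zt : n.-tuple (Z * Z) => select zt u).
Proof.
apply/measurable_fun_tnthP => i; rewrite /comp /select.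
apply: (eq_measurable_fun (fun zt : n.-tuple (Z * Z) =>
  if tnth u i then (tnth zt i).2 else (tnth zt i).1)) => [zt _|].
  by rewrite tnth_mktuple.
by case: (tnth u i); [apply: (measurableT_comp measurable_snd)|
  apply: (measurableT_comp measurable_fst)]; exact: measurable_tnth.
Qed.

Lemma measurable_ghost (u : n.-tuple bool) i :
  measurable_fun setT (fun zt : n.-tuple (Z * Z) => ghost zt u i).
Proof.
rewrite /ghost.
by case: (tnth u i); [apply: (measurableT_comp measurable_fst)|
  apply: (measurableT_comp measurable_snd)]; exact: measurable_tnth.
Qed.

Lemma measurable_set1_tuple (u : n.-tuple bool) : measurable [set u].
Proof.
rewrite (_ : [set u] = box (fun i => [set tnth u i])); first exact: measurable_box.
apply/seteqP; split => [_ -> //|v vu /=].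
by apply: eq_from_tnth => i; exact: vu.
Qed.

Lemma measurable_label u : measurable (U @^-1` [set u]).
Proof. by rewrite -[X in measurable X]setTI; apply: mU => //; exact: measurable_set1_tuple. Qed.

Hypothesis joint_law : forall (S : set (n.-tuple (Z * Z))) (u : n.-tuple bool) (C : set W),
     measurable S -> measurable C ->
     P (Zt @^-1` S `&` U @^-1` [set u] `&` Wh @^-1` C)
     = (((2%:R ^+ n)^-1)%:E * \int[P]_(om in Zt @^-1` S) A (select (Zt om) u) C)%E.

Let wt_ge0 : 0 <= (2%:R ^+ n)^-1 :> R.
Proof. by rewrite invr_ge0 exprn_ge0. Qed.

Local Open Scope ereal_scope.

(** Both sides integrate [F] against a finite measure on pairs (supersample, hypothesis), and
    [joint_law] says that the two measures agree on rectangles. *)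
Lemma integral_label_fixed (u : n.-tuple bool) (F : n.-tuple (Z * Z) * W -> \bar R) :
  (forall p, 0 <= F p) -> measurable_fun setT F ->
  \int[P]_om ((fun om => F (Zt om, Wh om)) \_ (U @^-1` [set u])) om =
  ((2%:R ^+ n)^-1)%:E * \int[P]_om \int[A (select (Zt om) u)]_w F (Zt om, w).
Proof.
move=> F0 mF.
have mZW : measurable_fun setT (fun om => (Zt om, Wh om)) by exact: measurable_fun_pair.
have mF' : measurable_fun setT (fun om => F (Zt om, Wh om)) by exact: measurableT_comp mF mZW.
rewrite -(ge0_integral_mrestr P (measurable_label u))//.
pose nu1 := image_measure mZW (mrestr P (measurable_label u)).
pose M : probability _ R := image_probability mZt P.
(* [kcomp] composes kernels, so the law of [Zt] becomes a constant kernel from [unit], and [kgraph]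
   is pulled back along [snd] to ignore that dummy argument. *)
pose l := kprobability (measurable_cst (M : pprobability _ R) : measurable_fun [set: unit] _).
pose k' := kpull (kgraph A (measurable_select u)) (measurable_snd : measurable_fun [set: unit * n.-tuple (Z * Z)] snd).
pose nu2 : {measure set _ -> \bar R} := mscale (NngNum wt_ge0) (kcomp l k' tt).
transitivity (\int[nu1]_p F p).
  by rewrite [RHS]ge0_integral_pushforward.
transitivity (\int[nu2]_p F p).
  apply: eq_measure_integral => E mE _.
  apply: eq_measure_rectangles mE => //.
    apply: (@le_lt_trans _ _ 1); last exact: ltry.
    apply: probability_le1; apply: measurableI; last exact: measurable_label.
    by rewrite preimage_setT.
  move=> S C mS mC.
  transitivity (((2%:R ^+ n)^-1)%:E *
      \int[P]_(om in Zt @^-1` S) A (select (Zt om) u) C).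
    rewrite -joint_law//; congr (P _); apply/seteqP.
    by split => [om [[? ?] ?]|om [[? ?] ?]].
  rewrite /nu2 /= /mscale /= /kcomp; congr (_ * _); rewrite [LHS]integral_mkcond.
  have mSC : measurable (S `*` C) by exact: measurableX.
  pose h z := kgraph A (measurable_select u) z (S `*` C).
  have mh : measurable_fun setT h by exact: measurable_kernel.
  rewrite [RHS](_ : _ = \int[M]_z h z)// [RHS]ge0_integral_pushforward//= preimage_setT.
  apply: eq_integral => om _; rewrite patchE /= /h /kgraph /= /pushforward /kpull.
  case: ifPn => [/set_mem|/negP] ZtS.
    by congr (A _ _); apply/seteqP; split => w //= [].
  rewrite (_ : _ @^-1` _ = set0) ?measure0//.
  by apply/seteqP; split => // w [] /= ? _; apply: ZtS; rewrite inE.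
rewrite ge0_integral_mscale// integral_kcomp//; congr (_ * _).
pose h z := \int[A (select z u)]_w F (z, w).
have mh : measurable_fun setT h by exact: measurable_integral_kpull (measurable_select u) _ _ _.
transitivity (\int[M]_z h z).
  by apply: eq_integral => z _; rewrite [LHS]ge0_integral_pushforward.
rewrite [LHS]ge0_integral_pushforward// => z _.
by apply: integral_ge0.
Qed.

End transport.

Section averages.
Context (R : realType) (n : nat) (dO : measure_display) (Omega : measurableType dO)
  (P : probability Omega R).

Lemma integral_mean (x : n.-tuple bool -> Omega -> R) :
  (forall u om, 0 <= x u om) -> (forall u, measurable_fun setT (x u)) ->
  (\int[P]_om (mean (x ^~ om))%:E =
   \sum_u ((2%:R ^+ n)^-1)%:E * \int[P]_om (x u om)%:E)%E.
Proof.
move=> x0 mx.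
have mEx u : measurable_fun setT (fun om => (x u om)%:E) by exact/measurable_EFinP.
have c0 : 0 <= (2%:R ^+ n)^-1 :> R by rewrite invr_ge0 exprn_ge0.
rewrite (eq_integral (fun om => \sum_u ((2%:R ^+ n)^-1)%:E * (x u om)%:E)%E); last first.
  by move=> om _; rewrite /mean mulr_sumr -sumEFin; apply: eq_bigr => u _; rewrite EFinM.
rewrite ge0_integral_sum//.
- by apply: eq_bigr => u _; rewrite ge0_integralZl//; move=> om _; rewrite lee_fin.
- by move=> u; apply: measurable_funeM.
- by move=> u om _; rewrite mule_ge0// lee_fin.
Qed.

Lemma measurable_mean (x : n.-tuple bool -> Omega -> R) :
  (forall u, measurable_fun setT (x u)) -> measurable_fun setT (fun om => mean (x ^~ om)).
Proof. by move=> mx; apply: measurable_funM => //; exact: measurable_sum. Qed.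

End averages.

Section labels.
Context (R : realType) (n : nat) (dZ dW dO : measure_display)
  (Z : measurableType dZ) (W : measurableType dW) (Omega : measurableType dO)
  (A : R.-pker (n.-tuple Z) ~> W) (P : probability Omega R)
  (Zt : Omega -> n.-tuple (Z * Z)) (U : Omega -> n.-tuple bool) (Wh : Omega -> W)
  (mZt : measurable_fun setT Zt) (mU : measurable_fun setT U)
  (mWh : measurable_fun setT Wh).
Local Open Scope ereal_scope.

(** The events [U = u] partition the sample space into finitely many pieces, each covered by
    [integral_label_fixed]. *)
Lemma integral_labels (F : n.-tuple bool -> n.-tuple (Z * Z) * W -> \bar R) :
  (forall (S : set (n.-tuple (Z * Z))) (u : n.-tuple bool) (C : set W),
     measurable S -> measurable C ->
     P (Zt @^-1` S `&` U @^-1` [set u] `&` Wh @^-1` C)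
     = (((2%:R ^+ n)^-1)%:E * \int[P]_(om in Zt @^-1` S) A (select (Zt om) u) C)%E) ->
  (forall u p, 0 <= F u p) -> (forall u, measurable_fun setT (F u)) ->
  \int[P]_om F (U om) (Zt om, Wh om) =
  \sum_u ((2%:R ^+ n)^-1)%:E * \int[P]_om \int[A (select (Zt om) u)]_w F u (Zt om, w).
Proof.
move=> joint_law F0 mF.
have mFu u : measurable_fun setT (fun om => F u (Zt om, Wh om)).
  exact: measurableT_comp (mF u) (measurable_fun_pair mZt mWh).
rewrite (eq_integral (fun om =>
    \sum_u ((fun om => F u (Zt om, Wh om)) \_ (U @^-1` [set u])) om)); last first.
  move=> om _; rewrite (bigD1 (U om))//= big1 ?adde0.
    by rewrite patchE mem_set.
  move=> u uU; rewrite patchE memNset//= => e.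
  by move: uU; rewrite e eqxx.
rewrite ge0_integral_sum//.
- by apply: eq_bigr => u _; exact: integral_label_fixed.
- move=> u; apply/(measurable_restrictT _ _).1; first exact: measurable_label.
  exact: measurable_funTS.
- by move=> u om _; rewrite patchE; case: ifP.
Qed.

End labels.

Section ghost_sample.
Context (R : realType) (n : nat) (dZ dO : measure_display)
  (Z : measurableType dZ) (Omega : measurableType dO)
  (mu : probability Z R) (P : probability Omega R)
  (Zt : Omega -> n.-tuple (Z * Z)) (mZt : measurable_fun setT Zt).
Hypothesis Zt_iid : forall B : 'I_n -> bool -> set Z, (forall i j, measurable (B i j)) ->
     P [set om | forall i : 'I_n,
                   B i false (tnth (Zt om) i).1 /\ B i true (tnth (Zt om) i).2]
     = (\prod_(i < n) (mu (B i false) * mu (B i true)))%E.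
Variables (u : n.-tuple bool) (i : 'I_n).
Local Open Scope ereal_scope.

Let sel om := select (Zt om) u.
Let gh om := ghost (Zt om) u i.

Let msel : measurable_fun setT sel.
Proof. exact: measurableT_comp (measurable_select u) mZt. Qed.

Let mgh : measurable_fun setT gh.
Proof. exact: measurableT_comp (measurable_ghost u i) mZt. Qed.

(* Under [Zt_iid], the ghost point of pair [i] is independent of the training
   sample and has law [mu]. *)
Lemma prob_select_ghost_box (B : 'I_n -> set Z) (C : set Z) :
  (forall j, measurable (B j)) -> measurable C ->
  P (sel @^-1` box B `&` gh @^-1` C) = \prod_(j < n) mu (B j) * mu C.
Proof.
move=> mB mC.
(* In pair [j] the selected entry is constrained by [B j]; the other entry is constrained by [C]
   when [j] is [i], and free otherwise. *)
pose D j := if j == i then C else setT.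
pose E j b := if b == tnth u j then B j else D j.
have mD j : measurable (D j) by rewrite /D; case: eqP.
have mE j b : measurable (E j b) by rewrite /E; case: eqP.
transitivity (\prod_(j < n) (mu (E j false) * mu (E j true))).
  rewrite -Zt_iid//; congr (P _); apply/seteqP; split => om.
    move=> [selB ghC] j; have := selB j.
    rewrite /sel /select tnth_mktuple /E /D; move: ghC; rewrite /gh /ghost /=.
    have [->|_] := eqVneq j i; first by case: (tnth u i) => /= ? ?; split.
    by move=> _; case: (tnth u j) => /= ?; split.
  move=> EZ; split => [j|].
    have := EZ j; rewrite /sel /select tnth_mktuple /E.
    by case: (tnth u j) => /= -[].
  have := EZ i; rewrite /gh /ghost /E /D eqxx /=.
  by case: (tnth u i) => /= -[].
rewrite (eq_bigr (fun j => mu (B j) * mu (D j))); last first.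
  by move=> j _; rewrite /E; case: (tnth u j) => //=; rewrite muleC.
rewrite big_split/=; congr (_ * _).
rewrite (bigD1 i)//= big1 ?mule1; first by rewrite /D eqxx.
by move=> j ji; rewrite /D (negbTE ji) probability_setT.
Qed.

(** With [C] fixed, both sides are finite measures in [S], so agreement on boxes suffices. *)
Lemma prob_select_ghost (S : set (n.-tuple Z)) (C : set Z) :
  measurable S -> measurable C ->
  P (sel @^-1` S `&` gh @^-1` C) = P (sel @^-1` S) * mu C.
Proof.
move=> mS mC.
have mghC : measurable (gh @^-1` C) by rewrite -[X in measurable X]setTI; exact: mgh.
have muC : mu C = (fine (mu C))%:E by rewrite fineK// fin_num_measure.
have muC0 : (0 <= fine (mu C))%R by rewrite fine_ge0.
pose m1 := image_measure msel (mrestr P mghC).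
pose m2 : {measure set _ -> \bar R} := mscale (NngNum muC0) (image_measure msel P).
transitivity (m1 S); first by [].
transitivity (m2 S); last by rewrite /m2 /= /mscale /= -muC muleC.
apply: eq_measure_boxes mS.
  apply: (@le_lt_trans _ _ 1); last exact: ltry.
  by apply: probability_le1; apply: measurableI => //; rewrite preimage_setT.
move=> B mB; rewrite [LHS]prob_select_ghost_box//.
rewrite /m2 /= /mscale /= -muC muleC; congr (_ * _).
(* The case [C = setT] gives the law of the training sample alone. *)
have := prob_select_ghost_box mB measurableT.
by rewrite preimage_setT setIT probability_setT mule1 => <-.
Qed.

(** By [prob_select_ghost] the pair (training sample, ghost point) has a product law, to which
    Tonelli's theorem applies. *)
Lemma integral_select_ghost (F : n.-tuple Z * Z -> \bar R) :
  (forall p, 0 <= F p) -> measurable_fun setT F ->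
  \int[P]_om F (select (Zt om) u, ghost (Zt om) u i) =
  \int[P]_om \int[mu]_z F (select (Zt om) u, z).
Proof.
move=> F0 mF.
have mp : measurable_fun setT (fun om => (sel om, gh om)) by exact: measurable_fun_pair.
pose M := image_probability msel P.
transitivity (\int[image_measure mp P]_p F p); first by rewrite [RHS]ge0_integral_pushforward.
transitivity (\int[M \x mu]_p F p).
  apply: eq_measure_integral => E mE _; apply/esym.
  apply: product_measure_unique => // S C mS mC.
  by rewrite -prob_select_ghost.
rewrite fubini_tonelli1// [LHS]ge0_integral_pushforward//=.
- exact: measurable_fun_fubini_tonelli_F.
- by move=> s _; apply: integral_ge0.
Qed.

End ghost_sample.

(** * The generalization error *)

Section bounded_risk.
Context (R : realType) (n : nat) (dZ dW : measure_display)
  (Z : measurableType dZ) (W : measurableType dW)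
  (A : R.-pker (n.-tuple Z) ~> W) (loss : W -> Z -> R)
  (loss_meas : measurable_fun setT (fun p : W * Z => loss p.1 p.2))
  (loss01 : forall w z, 0 <= loss w z <= 1).

Lemma integral_sum_loss (c : R) (s : n.-tuple Z) (z : 'I_n -> Z) : 0 <= c ->
  (\int[A s]_w (c * \sum_(i < n) loss w (z i))%:E =
   \sum_(i < n) c%:E * (risk A loss s (z i))%:E)%E.
Proof.
move=> c0; have loss_ge0 w z' : 0 <= loss w z' by have /andP[] := loss01 w z'.
have mloss z' : measurable_fun setT (fun w => (loss w z')%:E).
  by apply/measurable_EFinP; exact: measurable_loss_l.
rewrite (eq_integral (fun w => \sum_(i < n) c%:E * (loss w (z i))%:E)%E); last first.
  by move=> w _; rewrite mulr_sumr -sumEFin; apply: eq_bigr => i _; rewrite EFinM.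
rewrite ge0_integral_sum//; last 2 first.
- by move=> i; exact: measurable_funeM.
- by move=> i w _; rewrite mule_ge0 ?lee_fin.
apply: eq_bigr => i _; rewrite ge0_integralZl ?(integral_lossE A loss_meas loss01)//.
by move=> w _; rewrite lee_fin.
Qed.

Lemma measurable_risk :
  measurable_fun setT (fun p : n.-tuple Z * Z => risk A loss p.1 p.2).
Proof.
apply/measurable_EFinP.
rewrite (_ : EFin \o _ = (fun p => \int[A p.1]_w (loss w p.2)%:E)%E); last first.
  by apply/funext => p /=; rewrite (integral_lossE A loss_meas loss01).
(* The test point rides along as a parameter: [A] is pulled back along the first projection. *)
apply: (measurable_integral_kpull A measurable_fst
  (f := fun q : (n.-tuple Z * Z) * W => (loss q.2 q.1.2)%:E)).
  by move=> p; rewrite lee_fin; have /andP[] := loss01 p.2 p.1.2.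
apply/measurable_EFinP; apply: (measurableT_comp loss_meas
  (g := fun q : (n.-tuple Z * Z) * W => (q.2, q.1.2))).
apply: measurable_fun_pair; first exact: measurable_snd.
exact: measurableT_comp measurable_snd measurable_fst.
Qed.

Lemma gap_le_sqrte_dis_MI zt i :
  (`|gap A loss zt i|%:E <= sqrte (2%:E * dis_MI A loss zt i))%E.
Proof.
have h := le_dis_MI A loss_meas loss01 zt i.
have MI_ge0 : (0 <= dis_MI A loss zt i)%E.
  by apply: le_trans h; rewrite lee_fin divr_ge0// sqr_ge0.
rewrite -abse_EFin -sqrte_sqr lee_sqrt; last by rewrite mule_ge0.
rewrite -EFin_expe (_ : _ ^+ 2 = 2 * (gap A loss zt i ^+ 2 / 2)); last by field.
by rewrite EFinM lee_pmul2l.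
Qed.

Lemma dis_MI_ge0 zt i : (0 <= dis_MI A loss zt i)%E.
Proof.
apply: le_trans (le_dis_MI A loss_meas loss01 zt i).
by rewrite lee_fin divr_ge0// sqr_ge0.
Qed.

End bounded_risk.

Section generalization_error.
Context (R : realType) (n : nat) (dZ dW dO : measure_display)
  (Z : measurableType dZ) (W : measurableType dW) (Omega : measurableType dO)
  (mu : probability Z R) (A : R.-pker (n.-tuple Z) ~> W)
  (loss : W -> Z -> R)
  (loss_meas : measurable_fun setT (fun p : W * Z => loss p.1 p.2))
  (loss01 : forall w z, 0 <= loss w z <= 1)
  (P : probability Omega R)
  (Zt : Omega -> n.-tuple (Z * Z)) (U : Omega -> n.-tuple bool) (Wh : Omega -> W)
  (mZt : measurable_fun setT Zt) (mU : measurable_fun setT U)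
  (mWh : measurable_fun setT Wh)
  (Zt_iid : forall B : 'I_n -> bool -> set Z, (forall i j, measurable (B i j)) ->
     P [set om | forall i : 'I_n,
                   B i false (tnth (Zt om) i).1 /\ B i true (tnth (Zt om) i).2]
     = (\prod_(i < n) (mu (B i false) * mu (B i true)))%E)
  (joint_law : forall (S : set (n.-tuple (Z * Z))) (u : n.-tuple bool) (C : set W),
     measurable S -> measurable C ->
     P (Zt @^-1` S `&` U @^-1` [set u] `&` Wh @^-1` C)
     = (((2%:R ^+ n)^-1)%:E * \int[P]_(om in Zt @^-1` S) A (select (Zt om) u) C)%E).

Let test_risk i om :=
  mean (fun u => risk A loss (select (Zt om) u) (ghost (Zt om) u i)).
Let train_risk i om :=
  mean (fun u => risk A loss (select (Zt om) u) (tnth (select (Zt om) u) i)).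

Let loss_ge0 w z : 0 <= loss w z. Proof. by have /andP[] := loss01 w z. Qed.
Let risk_ge0 s z : 0 <= risk A loss s z.
Proof. by have /andP[] := risk01 A loss_meas loss01 s z. Qed.

Let m_test u i :
  measurable_fun setT (fun om => risk A loss (select (Zt om) u) (ghost (Zt om) u i)).
Proof.
apply: (measurableT_comp (measurable_risk A loss_meas loss01)
  (g := fun om => (select (Zt om) u, ghost (Zt om) u i))).
by apply: measurable_fun_pair; [exact: measurableT_comp (measurable_select u) mZt|
  exact: measurableT_comp (measurable_ghost u i) mZt].
Qed.

Let m_train u i :
  measurable_fun setT (fun om => risk A loss (select (Zt om) u) (tnth (select (Zt om) u) i)).
Proof.
have ms := measurableT_comp (measurable_select u) mZt.
apply: (measurableT_comp (measurable_risk A loss_meas loss01)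
  (g := fun om => (select (Zt om) u, tnth (select (Zt om) u) i))).
by apply: measurable_fun_pair => //; exact: measurableT_comp (measurable_tnth i) ms.
Qed.

Local Open Scope ereal_scope.

(* Swapping the test point for the ghost point of pair [i], whatever [i]. *)
Let population_loss (i : 'I_n) :
  \int[P]_om (\int[mu]_z (loss (Wh om) z)%:E) = \int[P]_om (test_risk i om)%:E.
Proof.
have mloss : measurable_fun setT (fun p : W * Z => (loss p.1 p.2)%:E).
  exact/measurable_EFinP.
pose K (w : W) := \int[mu]_z (loss w z)%:E.
have mK : measurable_fun setT K.
  apply: (@measurable_fun_fubini_tonelli_F _ _ _ _ _ mu (fun p : W * Z => (loss p.1 p.2)%:E)) => //.
  by move=> p; rewrite lee_fin.
rewrite (integral_labels mZt mU mWh (F := fun _ p => K p.2) joint_law); last 2 first.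
- by move=> _ p; apply: integral_ge0 => z _; rewrite lee_fin.
- by move=> _; exact: measurableT_comp mK measurable_snd.
rewrite integral_mean//; apply: eq_bigr => u _; congr (_ * _).
rewrite (integral_select_ghost mZt Zt_iid u i
  (F := fun p => (risk A loss p.1 p.2)%:E)); last 2 first.
- by move=> p; rewrite lee_fin.
- by apply/measurable_EFinP; exact: (measurable_risk A loss_meas loss01).
apply: eq_integral => om _; set s := select _ _.
transitivity (\int[law A s]_w \int[mu]_z (loss w z)%:E); first by [].
rewrite (fubini_tonelli (fun p => (loss p.1 p.2)%:E))//; last first.
  by move=> p; rewrite lee_fin.
by apply: eq_integral => z _; rewrite -(integral_lossE A loss_meas loss01).
Qed.

Let empirical_loss :
  \int[P]_om (n%:R^-1 * \sum_(i < n) loss (Wh om) (tnth (select (Zt om) (U om)) i))%:E =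
  (n%:R^-1)%:E * \sum_(i < n) \int[P]_om (train_risk i om)%:E.
Proof.
have n0 : (0 <= n%:R^-1 :> R)%R by rewrite invr_ge0.
rewrite (integral_labels mZt mU mWh (F := fun u p =>
  (n%:R^-1 * \sum_(i < n) loss p.2 (tnth (select p.1 u) i))%:E) joint_law); last 2 first.
- by move=> u p; rewrite lee_fin mulr_ge0// sumr_ge0.
- move=> u; apply/measurable_EFinP/measurable_funM => //.
  apply: measurable_sum => i; apply: (measurableT_comp loss_meas
    (g := fun p : n.-tuple (Z * Z) * W => (p.2, tnth (select p.1 u) i))).
  apply: measurable_fun_pair => //; apply: measurableT_comp (measurable_tnth i) _.
  exact: measurableT_comp (measurable_select u) measurable_fst.
transitivity (\sum_(i < n) (n%:R^-1)%:E * \int[P]_om (train_risk i om)%:E); last first.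
  by rewrite ge0_sume_distrr// => i _; apply: integral_ge0 => om _;
    rewrite lee_fin -(mean_cst n 0) le_mean.
under [RHS]eq_bigr => i _.
  rewrite integral_mean// ge0_sume_distrr; last first.
    by move=> u _; rewrite mule_ge0 ?lee_fin ?invr_ge0 ?exprn_ge0// integral_ge0// => om _; rewrite lee_fin.
  over.
rewrite exchange_big/=; apply: eq_bigr => u _.
rewrite (eq_integral (fun om => \sum_(i < n) (n%:R^-1)%:E *
    (risk A loss (select (Zt om) u) (tnth (select (Zt om) u) i))%:E)); last first.
  by move=> om _; exact: integral_sum_loss.
have mE i : measurable_fun setT (fun om =>
    (risk A loss (select (Zt om) u) (tnth (select (Zt om) u) i))%:E).
  exact/measurable_EFinP.
rewrite ge0_integral_sum//; last 2 first.
- by move=> i; exact: measurable_funeM.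
- by move=> i om _; rewrite mule_ge0 ?lee_fin.
rewrite ge0_sume_distrr; last first.
  by move=> i _; apply: integral_ge0 => om _; rewrite mule_ge0 ?lee_fin.
apply: eq_bigr => i _; rewrite ge0_integralZl; [exact: muleCA|by []|exact: mE| |].
  by move=> om _; rewrite lee_fin.
by rewrite lee_fin.
Qed.

Let test_risk_integrable i : P.-integrable setT (EFin \o test_risk i).
Proof.
apply: integrable01 => [|om]; first exact: measurable_mean.
by apply/andP; split; [rewrite -(mean_cst n 0)|rewrite -(mean_cst n 1)];
  apply: le_mean => u;
  have /andP[] := risk01 A loss_meas loss01 (select (Zt om) u) (ghost (Zt om) u i).
Qed.

Let train_risk_integrable i : P.-integrable setT (EFin \o train_risk i).
Proof.
apply: integrable01 => [|om]; first exact: measurable_mean.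
by apply/andP; split; [rewrite -(mean_cst n 0)|rewrite -(mean_cst n 1)];
  apply: le_mean => u;
  have /andP[] := risk01 A loss_meas loss01 (select (Zt om) u) (tnth (select (Zt om) u) i).
Qed.

Lemma integral_gap i : \int[P]_om (gap A loss (Zt om) i)%:E =
  \int[P]_om (test_risk i om)%:E - \int[P]_om (train_risk i om)%:E.
Proof.
rewrite -(integralB_EFin measurableT (test_risk_integrable i) (train_risk_integrable i)).
by apply: eq_integral => om _; rewrite /gap meanB.
Qed.

Lemma gen_err_gap : (0 < n)%N ->
  gen_err mu loss P Zt U Wh =
  (n%:R^-1)%:E * \sum_(i < n) \int[P]_om (gap A loss (Zt om) i)%:E.
Proof.
move=> n_gt0; rewrite /gen_err empirical_loss.
set t := (X in X - _ = _).
(* The population loss equals the expected ghost risk for every [i], hence also its average over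
   [i]; this lets it be subtracted term by term. *)
have tE i : t = \int[P]_om (test_risk i om)%:E by exact: population_loss.
have tfin : t \is a fin_num.
  (* Finiteness of [t] is read off at index [0], which exists since [n] is positive. *)
  by rewrite (tE (Ordinal n_gt0)); exact: (integrable_fin_num measurableT (test_risk_integrable _)).
pose b i := fine (\int[P]_om (train_risk i om)%:E).
have bE i : \int[P]_om (train_risk i om)%:E = (b i)%:E.
  by rewrite /b fineK//; exact: (integrable_fin_num measurableT (train_risk_integrable i)).
under eq_bigr do rewrite bE.
under [in RHS]eq_bigr do rewrite integral_gap bE -tE -(fineK tfin) -EFinB.
rewrite !sumEFin -!EFinM -{1}(fineK tfin) -EFinB; congr EFin.
rewrite sumrB sumr_const card_ord mulrBr -[(fine t *+ n)%R]mulr_natl mulKf//.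
by rewrite pnatr_eq0 -lt0n.
Qed.

Lemma measurable_gap i : measurable_fun setT (fun om => (gap A loss (Zt om) i)%:E).
Proof.
by apply/measurable_EFinP; apply: measurable_mean => u; exact: measurable_funB.
Qed.

End generalization_error.

Theorem theorem1 (R : realType) (n : nat) (n_gt0 : (0 < n)%N)
  (dZ dW dO : measure_display)
  (Z : measurableType dZ) (W : measurableType dW) (Omega : measurableType dO)
  (mu : probability Z R) (A : R.-pker (n.-tuple Z) ~> W)
  (loss : W -> Z -> R)
  (loss_meas : measurable_fun setT (fun p : W * Z => loss p.1 p.2))
  (loss01 : forall w z, 0 <= loss w z <= 1)
  (P : probability Omega R)
  (Zt : Omega -> n.-tuple (Z * Z)) (U : Omega -> n.-tuple bool) (Wh : Omega -> W)
  (mZt : measurable_fun setT Zt) (mU : measurable_fun setT U)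
  (mWh : measurable_fun setT Wh)
  (Zt_iid : forall B : 'I_n -> bool -> set Z, (forall i j, measurable (B i j)) ->
     P [set om | forall i : 'I_n,
                   B i false (tnth (Zt om) i).1 /\ B i true (tnth (Zt om) i).2]
     = (\prod_(i < n) (mu (B i false) * mu (B i true)))%E)
  (joint_law : forall (S : set (n.-tuple (Z * Z))) (u : n.-tuple bool) (C : set W),
     measurable S -> measurable C ->
     P (Zt @^-1` S `&` U @^-1` [set u] `&` Wh @^-1` C)
     = (((2%:R ^+ n)^-1)%:E * \int[P]_(om in Zt @^-1` S) A (select (Zt om) u) C)%E) :
  (`| gen_err mu loss P Zt U Wh |
     <= (n%:R^-1)%:E * \sum_(i < n) \int[P]_om sqrte (2%:E * dis_MI A loss (Zt om) i))%E
  /\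
  ((n%:R^-1)%:E * \sum_(i < n) \int[P]_om sqrte (2%:E * dis_MI A loss (Zt om) i)
     <= (n%:R^-1)%:E * \sum_(i < n) sqrte (2%:E * \int[P]_om dis_MI A loss (Zt om) i))%E.
Proof.
have MI_ge0 om i : (0 <= dis_MI A loss (Zt om) i)%E by exact: dis_MI_ge0.
have n0 : 0 <= n%:R^-1 :> R by rewrite invr_ge0.
split; last first.
  rewrite lee_wpmul2l ?lee_fin//; apply: lee_sum => i _.
  exact: integral_sqrte_le.
rewrite (gen_err_gap loss_meas loss01 mZt mU mWh Zt_iid joint_law n_gt0).
rewrite abseM gee0_abs ?lee_fin// lee_wpmul2l ?lee_fin//.
apply: (le_trans (lee_abs_sum _ _ _)); apply: lee_sum => i _.
apply: (le_trans (le_abse_integral _ _ _)) => //; first exact: measurable_gap.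
(* From here the upper bound involves [dis_MI], so the comparison is between lower integrals. *)
apply: ge0_le_integral_lower => om; first exact: abse_ge0.
exact: gap_le_sqrte_dis_MI.
Qed.
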